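(* Let $F:X\to Y^*$ be a continuous (nonlinear) map, and suppose that $u\in X$ is a locally unique solution, in a neighborhood $U\subseteq X$ of $u$, of the problem: find $u\in X$ such that $\langle F(u),v\rangle=0$ for all $v\in Y$. Let $\{u_k\}\subset U$ be a sequence converging (in $X$) to some $u_*\in U$, such that $$\lim_{k\to\infty}\langle F(u_k),v\rangle=0\qquad\text{for all } v\in Y.$$ Then $u_*=u$.
   Context: $X$ and $Y$ are real Banach spaces, $Y^*$ is the topological dual of $Y$, and $\langle\cdot,\cdot\rangle$ is the duality pairing between $Y^*$ and $Y$. A solution $u\in X$ of $F(u)=0$ is called locally unique in a neighborhood $U\subset X$ of $u$ if $u$ is the only solution of $F(u)=0$ in $U$. *)

(* Defs.v *)
From HB Require Import structures.
From mathcomp Require Import all_boot all_order all_algebra.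
From mathcomp Require Import all_classical all_reals all_analysis.

Set Implicit Arguments.
Unset Strict Implicit.
Unset Printing Implicit Defensive.

Import Order.TTheory GRing.Theory Num.Theory.
Import numFieldNormedType.Exports.

Local Open Scope classical_set_scope.
Local Open Scope ring_scope.

Section Dual.
Context (R : realType) (Y : normedModType R).

Definition continuous_linear : {pred Y -> R} :=
  [pred f : Y -> R | `[< linear f /\ continuous f >]].

Record dual := Dual {
  dual_val :> Y -> R ;
  dual_valP : dual_val \in continuous_linear }.

HB.instance Definition _ := [isSub for dual_val].
HB.instance Definition _ := [Choice of dual by <:].

Lemma continuous_linear_submod_closed : submod_closed continuous_linear.
Proof.
split.
  apply/asboolP; split; last exact: cst_continuous.
  by move=> a x y /=; rewrite scaler0 addr0.
move=> a f g /asboolP[fl fc] /asboolP[gl gc]; apply/asboolP; split.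
  move=> b x y; rewrite /= !fctE fl gl /GRing.scale /=.
  by rewrite !mulrDr mulrCA addrACA.
move=> x; apply: (@continuousD _ _ _ (a *: f) g); last exact: gc.
by apply: continuousZl_tmp; exact: fc.
Qed.

HB.instance Definition _ := GRing.isSubmodClosed.Build _ _ continuous_linear
  continuous_linear_submod_closed.

HB.instance Definition _ := [SubChoice_isSubLmodule of dual by <:].

Implicit Types (f g : dual) (y : Y).

Lemma dual_linear f : linear f.
Proof. by have /asboolP[] := dual_valP f. Qed.

Lemma dual_continuous f : continuous f.
Proof. by have /asboolP[] := dual_valP f. Qed.

HB.instance Definition _ f :=
  GRing.isLinear.Build R Y R _ (dual_val f) (@dual_linear f).

(* The operator norm; it makes [dual] a normedModType below, so that continuity
   of a map into [dual] is meant for the norm topology. *)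
Definition dual_norm f : R := sup [set `|f y| | y in [set y | `|y| <= 1]].

Lemma dual_norm_has_sup f : has_sup [set `|f y| | y in [set y | `|y| <= 1]].
Proof.
split; first by exists `|f 0|, 0 => //=; rewrite normr0 ler01.
have [r r0 fr] : exists2 r, 0 < r & forall x, `|f x| <= r * `|x|.
  apply/pinfty_ex_gt0/linear_boundedP/linear_bounded_continuous.
  exact: dual_continuous.
exists r => _ [y /= y1 <-]; apply: (le_trans (fr y)).
by rewrite ler_piMr// ltW.
Qed.

Lemma ler_dual_norm f y : `|f y| <= dual_norm f * `|y|.
Proof.
have [->|y0] := eqVneq y 0; first by rewrite linear0 !normr0 mulr0.
have ny0 : 0 < `|y| by rewrite normr_gt0.
rewrite -ler_pdivrMr//; apply: (ub_le_sup (dual_norm_has_sup f).2).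
exists (`|y|^-1 *: y) => /=.
  by rewrite normrZ ger0_norm ?invr_ge0// mulVf// gt_eqF.
by rewrite linearZ/= normrM ger0_norm ?invr_ge0// mulrC.
Qed.

Lemma dual_norm_ge0 f : 0 <= dual_norm f.
Proof.
apply: (@le_trans _ _ `|f 0|) => //; apply: (ub_le_sup (dual_norm_has_sup f).2).
by exists 0 => //=; rewrite normr0 ler01.
Qed.

Lemma dual_norm_le f M :
  (forall y, `|y| <= 1 -> `|f y| <= M) -> dual_norm f <= M.
Proof.
move=> fM; apply: ge_sup; first exact: (dual_norm_has_sup f).1.
by move=> _ [y /= y1 <-]; exact: fM.
Qed.

Lemma ler_dual_norm1 f y : `|y| <= 1 -> `|f y| <= dual_norm f.
Proof.
by move=> y1; rewrite (le_trans (ler_dual_norm f y))// ler_piMr// dual_norm_ge0.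
Qed.

Lemma dual_normD f g : dual_norm (f + g) <= dual_norm f + dual_norm g.
Proof.
apply: dual_norm_le => y y1.
by rewrite (le_trans (ler_normD _ _))// lerD// ler_dual_norm1.
Qed.

Lemma dual_normZ_le a f : dual_norm (a *: f) <= `|a| * dual_norm f.
Proof.
apply: dual_norm_le => y y1.
by rewrite [leLHS]normrM ler_wpM2l// ler_dual_norm1.
Qed.

Lemma dual_normZ a f : dual_norm (a *: f) = `|a| * dual_norm f.
Proof.
apply/eqP; rewrite eq_le dual_normZ_le /=.
have [->|a0] := eqVneq a 0; first by rewrite normr0 mul0r dual_norm_ge0.
rewrite -ler_pdivlMl ?normr_gt0// -normfV.
by rewrite -{1}(scalerK a0 f) dual_normZ_le.
Qed.

Lemma dual_norm0_eq0 f : dual_norm f = 0 -> f = 0.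
Proof.
move=> f0; apply: val_inj; apply/funext => y /=; apply/eqP.
by rewrite -normr_le0 (le_trans (ler_dual_norm f y))// f0 mul0r.
Qed.

HB.instance Definition _ :=
  @Lmodule_isNormed.Build R dual dual_norm dual_normD dual_normZ dual_norm0_eq0.

Definition pairing f y : R := f y.

End Dual.

Section WeakProblem.
Context (R : realType) (X Y : normedModType R).

Definition weak_solution (F : X -> dual Y) : set X :=
  [set u | forall v : Y, pairing (F u) v = 0].

Definition locally_unique_solution (F : X -> dual Y) (U : set X) (u : X) :=
  [/\ nbhs u U, weak_solution F u &
      forall w, U w -> weak_solution F w -> w = u].

End WeakProblem.

(* Main.v *)
Require Import Defs.
From HB Require Import structures.
From mathcomp Require Import all_boot all_order all_algebra.
From mathcomp Require Import all_classical all_reals all_analysis.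
Import Order.TTheory GRing.Theory Num.Theory.
Import numFieldNormedType.Exports.
Local Open Scope classical_set_scope.
Local Open Scope ring_scope.

(** Evaluation at a fixed [v] is continuous for the operator norm, so each
    scalar map [fun w => pairing (F w) v] is continuous. Along the sequence its
    values therefore tend both to the value at [ustar] and to [0]; limits in
    [R] being unique, [ustar] is a weak solution, and it lies in the set where
    [u] is the only one. *)

(** The operator norm makes evaluation at [v] a linear map bounded by [`|v|]. *)
Lemma pairing_continuous (R : realType) (Y : normedModType R) (v : Y) :
  continuous (fun f : dual Y => pairing f v).
Proof.
have ev_linear : linear (fun f : dual Y => pairing f v) by [].
pose evM := GRing.isLinear.Build R (dual Y) R _ _ ev_linear.
pose ev : {linear dual Y -> R} := HB.pack (fun f : dual Y => pairing f v) evM.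
apply: (@linear_bounded_continuous R (dual Y) R ev).1.
apply/linear_boundedP; exists `|v|; split=> [|r vr f]; first exact: normr_real.
apply: le_trans (ler_dual_norm f v) _.
by rewrite mulrC; apply: ler_wpM2r (dual_norm_ge0 f) _ _ (ltW vr).
Qed.

Lemma weak_solution_lim (R : realType) (X Y : normedModType R)
    (F : X -> dual Y) (u_ : nat -> X) (w : X) :
  {for w, continuous F} ->
  u_ k @[k --> \oo] --> w ->
  (forall v : Y, pairing (F (u_ k)) v @[k --> \oo] --> (0 : R)) ->
  weak_solution F w.
Proof.
move=> Fw u_w Fu0 v.
have F_w : F (u_ k) @[k --> \oo] --> F w := cvg_comp _ _ u_w Fw.
have pF_w := cvg_comp _ _ F_w (pairing_continuous _ _ v (F w)).
exact: (cvg_unique _ pF_w (Fu0 v)).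
Qed.

Theorem theorem2p2 (R : realType) (X Y : completeNormedModType R)
    (F : X -> dual Y) (U : set X) (u : X) (u_ : nat -> X) (ustar : X) :
  continuous F ->
  locally_unique_solution F U u ->
  (forall k, U (u_ k)) ->
  U ustar ->
  u_ k @[k --> \oo] --> ustar ->
  (forall v : Y, pairing (F (u_ k)) v @[k --> \oo] --> (0 : R)) ->
  ustar = u.
Proof.
move=> Fc [_ _ uniq_u] _ Uustar u_ustar Fu0.
by apply: uniq_u => //; apply: weak_solution_lim (Fc ustar) u_ustar Fu0.
Qed.
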